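(* Let $D\colon BU\to\mathbb{R}^m$ be an operator satisfying (D1)–(D3), of the form $Dx=x(0)-\int_{-\infty}^0[d\nu(s)]\,x(s)$ (as in the context), and assume that $D$ is stable. Let $\widehat D\colon BU\to BU$ be defined by $(\widehat Dx)(s)=Dx_s$ for $s\le 0$. Then $\widehat D$ is invertible, $\widehat D^{-1}$ is bounded for the norm $\|\cdot\|_\infty$, and $\widehat D^{-1}$ is uniformly continuous when we take the restriction of the compact-open topology to $B_r$ for each $r>0$; i.e. given $r>0$ and $\varepsilon>0$ there is a $\delta(r)>0$ such that $\mathsf{d}(\widehat D^{-1}h_1,\widehat D^{-1}h_2)<\varepsilon$ for all $h_1,h_2\in B_r$ with $\mathsf{d}(h_1,h_2)<\delta(r)$.
   Context: Notation. $\|\cdot\|$ is the maximum norm on $\mathbb{R}^m$. $X=C((-\infty,0],\mathbb{R}^m)$ carries the compact-open topology, given by the metric $\mathsf{d}(x,y)=\sum_{n\ge1}2^{-n}\frac{\|x-y\|_n}{1+\|x-y\|_n}$, $\|x\|_n=\sup_{s\in[-n,0]}\|x(s)\|$. $BU\subset X$ is the Banach space of bounded uniformly continuous functions with norm $\|x\|_\infty=\sup_{s\le0}\|x(s)\|$, and $B_r=\{x\in BU:\|x\|_\infty\le r\}$. For a continuous $x\colon(-\infty,a]\to\mathbb{R}^m$ and $t\le a$, $x_t\in X$ is defined by $x_t(s)=x(t+s)$, $s\le0$. Hypotheses on $D\colon BU\to\mathbb{R}^m$: (D1) $D$ is linear and continuous for $\|\cdot\|_\infty$. (D2) For each $r>0$,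 the restriction $D\colon B_r\to\mathbb{R}^m$ is continuous for the compact-open topology on $B_r$. (D3) $D$ is atomic at $0$, i.e. in the representation $Dx=\int_{-\infty}^0[d\mu(s)]x(s)$ with $\mu=[\mu_{ij}]$ a matrix of real regular Borel measures of finite total variation (which exists by (D1)–(D2)), $\det[\mu_{ij}(\{0\})]\ne0$. It is a standing normalization that $Dx=x(0)-\int_{-\infty}^0[d\nu(s)]\,x(s)$, where $\nu=[\nu_{ij}]_{i,j=1}^m$, each $\nu_{ij}$ is a real regular Borel measure on $(-\infty,0]$ with finite total variation, and $|\nu_{ij}|(\{0\})=0$. Stability: $D$ is stable if there is a continuous $c\colon[0,\infty)\to[0,\infty)$ with $\lim_{t\to\infty}c(t)=0$ such that, for each $\varphi\in BU$ with $D\varphi=0$, the solution $x$ of $Dx_t=0$ for $t\ge0$, $x_0=\varphi$, satisfies $\|x(t)\|\le c(t)\|\varphi\|_\infty$ for each $t\ge0$. (Here a solution is a continuous function $x\colon\mathbb{R}\to\mathbb{R}^m$; it exists and is unique.) *)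

(* Defs.v *)
From HB Require Import structures.
From mathcomp Require Import all_boot all_order all_algebra.
From mathcomp Require Import all_classical all_reals all_analysis.

Set Implicit Arguments.
Unset Strict Implicit.
Unset Printing Implicit Defensive.

Import Order.TTheory GRing.Theory Num.Theory.
Import numFieldNormedType.Exports.

Local Open Scope classical_set_scope.
Local Open Scope ring_scope.

(* The half-line (-oo, 0] is a type of its own, so that functions on it are
   compared by Leibniz equality; it has the metric induced from R and the Borel
   sigma-algebra of its topology. *)
Definition halfline (R : realType) : Type := [set` `]-oo, (0 : R)]].

HB.instance Definition _ (R : realType) :=
  PseudoMetric.copy (halfline R) [set` `]-oo, (0 : R)]].

Definition half_val (R : realType) (s : halfline R) : R := set_val s.

Definition half (R : realType) (t : R) (t0 : t <= 0) : halfline R :=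
  exist _ t (mem_set t0).

Lemma half_le0 (R : realType) (s : halfline R) : half_val s <= 0.
Proof. by case: s => s sP; have := set_mem sP; rewrite /= in_itv. Qed.

Lemma half_add_subproof (R : realType) (t s : halfline R) :
  half_val t + half_val s <= 0.
Proof. by rewrite -[leRHS]addr0 lerD// half_le0. Qed.

Definition half0 (R : realType) : halfline R := half (lexx 0).

Definition half_add (R : realType) (t s : halfline R) : halfline R :=
  half (half_add_subproof t s).

Lemma half_addE (R : realType) (t s : halfline R) :
  half_val (half_add t s) = half_val t + half_val s.
Proof. by []. Qed.

HB.instance Definition _ (R : realType) :=
  isPointed.Build (halfline R) (half0 R).

HB.instance Definition _ (R : realType) :=
  @isMeasurable.Build (sigma_display (@open (halfline R))) (halfline R)
    <<s @open (halfline R) >> (@sigma_algebra0 _ setT _) (@sigma_algebraC _ _)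
    (@sigma_algebra_bigcup _ setT _).

Lemma half_ballE (R : realType) (s : halfline R) (e : R) (t : halfline R) :
  ball s e t = (`|half_val s - half_val t| < e).
Proof. by []. Qed.

Section history_space.
Context {R : realType} {m : nat}.
Local Notation V := 'cV[R]_m.

(* The norm of 'cV[R]_m is the maximum norm; see mx_normrE. *)
Definition seminorm (n : nat) (x : halfline R -> V) : R :=
  sup [set `|x s| | s in [set s | - n%:R <= half_val s]].

(* The metric of the compact-open topology of C((-oo, 0], R^m). *)
Definition codist (x y : halfline R -> V) : R :=
  \big[+%R/0]_(1 <= n <oo)
    (2^-1 ^+ n * (seminorm n (x \- y) / (1 + seminorm n (x \- y)))).

Definition history (x : R -> V) (t : R) : halfline R -> V :=
  fun s => x (t + half_val s).

Definition BU_pred : {pred halfline R -> V} :=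
  mem [set x | bounded_fun x /\ unif_continuous x].

End history_space.

Record BU (R : realType) (m : nat) := MkBU {
  bu_fun :> halfline R -> 'cV[R]_m;
  _ : bu_fun \in BU_pred
}.

HB.instance Definition _ (R : realType) (m : nat) :=
  [isSub for @bu_fun R m].
HB.instance Definition _ (R : realType) (m : nat) :=
  [Choice of BU R m by <:].

Section BU_lmodule.
Context {R : realType} {m : nat}.
Local Notation V := 'cV[R]_m.

Lemma BU_predP (x : halfline R -> V) :
  x \in BU_pred <-> (exists M, forall s, `|x s| <= M) /\
    forall e, 0 < e -> exists2 d, 0 < d &
      forall s t, `|half_val s - half_val t| < d -> `|x s - x t| < e.
Proof.
rewrite inE /=; split=> -[bx ux]; split.
- by have /pinfty_ex_gt0[M _ hM] := bx; exists M => s; exact: hM.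
- move=> e e0; move/unif_continuousP : ux => /(_ e e0)[d /= d0 hd].
  exists d => // s t st; have := hd (s, t); rewrite /= half_ballE => /(_ st).
  by rewrite -ball_normE.
- have [M hM] := bx; exists M; split; first exact: num_real.
  by move=> y My s _; exact: le_trans (hM s) (ltW My).
- apply/unif_continuousP => e e0; have [d d0 hd] := ux e e0.
  exists d => //= -[s t] /=; rewrite half_ballE => /hd.
  by rewrite -ball_normE.
Qed.

Lemma BU_submod_closed : submod_closed (@BU_pred R m).
Proof.
split.
  apply/BU_predP; split; first by exists 0 => s; rewrite normr0.
  by move=> e e0; exists 1 => // s t _; rewrite subrr normr0.
move=> k x y /BU_predP[[M hM] ux] /BU_predP[[N hN] uy]; apply/BU_predP; split.
  exists (`|k| * M + N) => s; rewrite (le_trans (ler_normD _ _))// lerD//.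
  by rewrite normrZ ler_wpM2l.
move=> e e0; have k0 : 0 < `|k| + 1 by rewrite ltr_wpDl.
have [d d0 hd] := ux (e / 2 / (`|k| + 1)) ltac:(by rewrite !divr_gt0).
have [d' d'0 hd'] := uy (e / 2) ltac:(by rewrite divr_gt0).
exists (Num.min d d'); first by rewrite lt_min d0.
move=> s t; rewrite lt_min => /andP[/hd sx /hd' sy].
have -> : (k *: x + y) s - (k *: x + y) t = k *: (x s - x t) + (y s - y t).
  by rewrite scalerBr opprD addrACA.
rewrite (le_lt_trans (ler_normD _ _))// (splitr e) ler_ltD// normrZ.
rewrite (@le_trans _ _ ((`|k| + 1) * `|x s - x t|))//.
  by rewrite ler_wpM2r// lerDl.
by rewrite mulrC -ler_pdivlMr// ltW.
Qed.

HB.instance Definition _ :=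
  GRing.isSubmodClosed.Build _ _ (@BU_pred R m) BU_submod_closed.

HB.instance Definition _ := [SubChoice_isSubLmodule of BU R m by <:].

Definition bu_norm (x : BU R m) : R := sup (range (fun s => `|x s|)).

Lemma BU_ubound (x : BU R m) : has_ubound (range (fun s => `|x s|)).
Proof.
have /BU_predP[[M hM] _] := valP x.
by exists M => _ [s _ <-]; exact: hM.
Qed.

Lemma ler_bu_norm (x : BU R m) s : `|x s| <= bu_norm x.
Proof. by apply: ub_le_sup; [exact: BU_ubound|exists s]. Qed.

Lemma bu_norm_le (x : BU R m) M : (forall s, `|x s| <= M) -> bu_norm x <= M.
Proof.
move=> hM; apply: ge_sup; first by exists `|x (half0 R)|, (half0 R).
by move=> _ [s _ <-].
Qed.

Lemma ler_bu_normD x y : bu_norm (x + y) <= bu_norm x + bu_norm y.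
Proof.
apply: bu_norm_le => s; rewrite (le_trans (ler_normD (x s) (y s)))//.
by rewrite lerD// ler_bu_norm.
Qed.

Lemma bu_normZ (l : R) x : bu_norm (l *: x) = `|l| * bu_norm x.
Proof.
have le k (y : BU R m) : bu_norm (k *: y) <= `|k| * bu_norm y.
  by apply: bu_norm_le => s; rewrite normrZ ler_wpM2l// ler_bu_norm.
apply/eqP; rewrite eq_le le /=; have [->|l0] := eqVneq l 0.
  by rewrite normr0 mul0r (le_trans _ (ler_bu_norm _ (half0 R))).
rewrite -ler_pdivlMl ?normr_gt0// -normfV.
by rewrite -[x in bu_norm x <= _](scalerK l0) le.
Qed.

Lemma bu_norm0_eq0 x : bu_norm x = 0 -> x = 0.
Proof.
move=> x0; apply/val_inj/funext => s; apply/normr0_eq0/eqP.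
by rewrite eq_le normr_ge0 -[leRHS]x0 ler_bu_norm.
Qed.

HB.instance Definition _ := @Lmodule_isNormed.Build R (BU R m)
  bu_norm ler_bu_normD bu_normZ bu_norm0_eq0.


Lemma BU_shift_subproof (x : BU R m) (t : halfline R) :
  (fun s => x (half_add t s)) \in BU_pred.
Proof.
have /BU_predP[[M hM] ux] := valP x.
apply/BU_predP; split; first by exists M => s; exact: hM.
move=> e /ux[d d0 hd]; exists d => // s u su; apply: hd.
by rewrite !half_addE opprD addrACA subrr add0r.
Qed.

Definition BU_shift (x : BU R m) (t : halfline R) : BU R m :=
  MkBU (BU_shift_subproof x t).

Section Dhat.
Variables (D : {linear BU R m -> V}) (D_cont : continuous D).

Lemma Dhat_subproof (x : BU R m) : (fun s => D (BU_shift x s)) \in BU_pred.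
Proof.
have /linear_boundedP[M [_ hM]] := @continuous_linear_bounded _ _ _ 0 D (@D_cont 0).
pose C := `|M| + 1; have C0 : 0 < C by rewrite ltr_wpDl.
have hC y : `|D y| <= C * bu_norm y.
  by apply: hM; rewrite (le_lt_trans (ler_norm _))// ltrDl.
have /BU_predP[_ ux] := valP x.
apply/BU_predP; split.
  exists (C * bu_norm x) => s; rewrite (le_trans (hC _))// ler_pM2l//.
  by apply: bu_norm_le => u; exact: (ler_bu_norm x (half_add s u)).
move=> e e0; have [d d0 hd] := ux (e / 2 / C) ltac:(by rewrite !divr_gt0).
exists d => // s t st; rewrite -linearB (le_lt_trans (hC _))//.
rewrite (@le_lt_trans _ _ (e / 2))//; last first.
  by rewrite ltr_pdivrMr// ltr_pMr// ltr1n.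
rewrite mulrC -ler_pdivlMr//; apply: bu_norm_le => u; apply/ltW/hd.
by rewrite !half_addE opprD addrACA subrr addr0.
Qed.

Definition Dhat (x : BU R m) : BU R m := MkBU (Dhat_subproof x).
End Dhat.
End BU_lmodule.

Section neutral_operator.
Context {R : realType} {m : nat}.
Local Notation V := 'cV[R]_m.
Local Notation signed_measure := ({charge set (halfline R) -> \bar R})%R.

Lemma hahn_of_subproof (nu : signed_measure) :
  exists PN : set (halfline R) * set (halfline R),
    hahn_decomposition nu PN.1 PN.2.
Proof. by have [P [N PN]] := Hahn_decomposition nu; exists (P, N). Qed.

Definition hahn_of (nu : signed_measure) := cid (hahn_of_subproof nu).

(* The Jordan parts do not depend on the chosen decomposition; see
   Hahn_decomposition_uniq. Charges take finite values only, so their total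
   variation is always finite. *)
Definition charge_tv (nu : signed_measure) : set (halfline R) -> \bar R :=
  charge_variation (svalP (hahn_of nu)).

Definition charge_integral (nu : signed_measure) (f : halfline R -> R) : R :=
  \int[jordan_pos (svalP (hahn_of nu))]_s f s
  - \int[jordan_neg (svalP (hahn_of nu))]_s f s.

Definition regular_charge (nu : signed_measure) : Prop :=
  forall (A : set (halfline R)) (e : R), measurable A -> 0 < e ->
    exists K U, [/\ compact K, open U, K `<=` A, A `<=` U &
      (charge_tv nu (U `\` K) < e%:E)%E].

Definition mx_integral (mu : 'I_m -> 'I_m -> signed_measure)
    (x : halfline R -> V) : V :=
  \col_i \sum_j charge_integral (mu i j) (fun s => x s j 0).

(* BU with the compact-open topology; the topology of BU R m itself is the one
   of its norm. *)
Definition compact_open_BU : Type :=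
  initial_topology (fun x : BU R m =>
    (x : halfline R -> V) : {compact-open, halfline R -> V}).

Definition BU_ball (r : R) : set (BU R m) := [set x | `|x| <= r].

Definition compact_open_continuous (D : BU R m -> V) : Prop :=
  forall r : R, 0 < r ->
    {within (BU_ball r : set compact_open_BU),
      continuous (D : compact_open_BU -> V)}.

(* By the Riesz theorem at most one mu represents D, so it does not matter that
   mu is quantified existentially. *)
Definition atomic_at0 (D : BU R m -> V) : Prop :=
  exists mu : 'I_m -> 'I_m -> signed_measure,
    [/\ forall i j, regular_charge (mu i j),
        forall x, D x = mx_integral mu x &
        \det (\matrix_(i, j) fine (mu i j [set half0 R])) != 0].

(* D is only defined on BU; a continuous x with x_0 in BU has all its histories
   x_t (t >= 0) in BU, so the membership asserted here adds no constraint. *)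
Definition is_solution (D : BU R m -> V) (phi : BU R m) (x : R -> V) : Prop :=
  [/\ continuous x, history x 0 = phi &
      forall t, 0 <= t -> exists2 y : BU R m, history x t = y & D y = 0].

Definition stable (D : BU R m -> V) : Prop :=
  exists c : R -> R,
    [/\ {within `[0, +oo[, continuous c}, forall t, 0 <= t -> 0 <= c t,
        c t @[t --> +oo] --> 0 &
        forall (phi : BU R m) (x : R -> V), D phi = 0 -> is_solution D phi x ->
          forall t, 0 <= t -> `|x t| <= c t * `|phi|].

End neutral_operator.

(* Main.v *)
Require Import Defs.
From HB Require Import structures.
From mathcomp Require Import all_boot all_order all_algebra.
From mathcomp Require Import all_classical all_reals all_analysis.
From mathcomp Require Import measurable_realfun lra.

Set Implicit Arguments.
Unset Strict Implicit.
Unset Printing Implicit Defensive.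

Import Order.TTheory GRing.Theory Num.Theory.
Import numFieldNormedType.Exports.

Local Open Scope classical_set_scope.
Local Open Scope ring_scope.

(* Let T be the operator x |-> (s |-> D x_s).  Since nu has no mass at 0, I - T
   contracts by 1/2 the functions vanishing on (-oo, -a], for some a > 0; hence
   T is invertible on these, and, proceeding by steps of length a, on the
   functions vanishing on (-oo, -b] for every b.  Given x, solve T z = T x
   (cut off) for such a z; then w = x - z satisfies D w_s = 0 on [-b, 0], it
   extends to a solution on the whole line, and stability gives
     |x(0)| <= e |x| + K sup_[-b-1, 0] |T x|,
   with e arbitrarily small for b large.  By translation this bounds x at every
   point.  For e = 1/2 it yields |x| <= 2 K |T x|; in general it yields the
   uniform continuity of the inverse for the compact-open topology, and it makes
   the preimages of the cut-offs of h a Cauchy sequence for that topology, whose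
   limit is a preimage of h. *)

(** * Bounds for integrals against finite measures and charges *)

Lemma continuous_halfline_measurable (R : realType) (f : halfline R -> R) :
  continuous f -> measurable_fun setT f.
Proof.
move=> /continuousP cf; apply: (measurability _ (RGenOpens.measurableE R)).
move=> _ [_ [a [b ->] <-]]; rewrite setTI; apply: sub_sigma_algebra.
exact/cf/interval_open.
Qed.

Section bounded_integrals.
Context d (T : measurableType d) (R : realType).
Variable mu : {finite_measure set T -> \bar R}.

Lemma bounded_Rintegrable (f : T -> R) (A : set T) (M : R) :
  measurable A -> measurable_fun setT f -> (forall x, A x -> `|f x| <= M) ->
  mu.-integrable A (EFin \o f).
Proof.
move=> mA mf fM; apply: measurable_bounded_integrable => //.
- by rewrite ltey_eq fin_num_measure.
- exact: measurable_funTS.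
- exists M; split => [|y My x Ax]; first exact: num_real.
  exact: le_trans (fM _ Ax) (ltW My).
Qed.

Lemma normr_Rintegral_le (f : T -> R) (A : set T) (M : R) :
  measurable A -> measurable_fun setT f -> (forall x, A x -> `|f x| <= M) ->
  `|\int[mu]_(x in A) f x| <= M * fine (mu A).
Proof.
move=> mA mf fM; have fi := bounded_Rintegrable mA mf fM.
apply: (le_trans (le_normr_Rintegral mA fi)).
rewrite -Rintegral_cst//; apply: le_Rintegral => //.
- apply: (@bounded_Rintegrable (fun x => `|f x|) _ M) => //.
    exact: measurableT_comp.
  by move=> x /fM; rewrite normr_id.
- apply: (@bounded_Rintegrable (fun=> M) _ `|M|) => //.
Qed.

Lemma normr_Rintegral_le_split (f : T -> R) (A : set T) (M1 M2 : R) :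
  measurable A -> measurable_fun setT f ->
  (forall x, A x -> `|f x| <= M1) -> (forall x, ~ A x -> `|f x| <= M2) ->
  `|\int[mu]_x f x| <= M1 * fine (mu A) + M2 * fine (mu (~` A)).
Proof.
move=> mA mf f1 f2; rewrite -(setUv A) Rintegral_setU//.
- rewrite (le_trans (ler_normD _ _))// lerD// normr_Rintegral_le//.
  exact: measurableC.
- exact: measurableC.
- rewrite setUv; apply: (@bounded_Rintegrable _ _ (Num.max M1 M2)) => // x _.
  by rewrite le_max; have [/f1->//|/f2->] := pselect (A x); rewrite orbT.
- by apply/disj_set2P; rewrite setICr.
Qed.

End bounded_integrals.

Section charges.
Context {R : realType}.
Variable nu : {charge set (halfline R) -> \bar R}.



(** The integral is a difference of integrals against the two Jordan parts and the total variation
    is their sum, so the bounds for the parts add up. The splitting along [A] serves both near 0 and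
    near minus infinity. *)
Lemma normr_charge_integral_le (f : halfline R -> R) (A : set (halfline R))
    (M1 M2 : R) :
  measurable A -> continuous f ->
  (forall s, A s -> `|f s| <= M1) -> (forall s, ~ A s -> `|f s| <= M2) ->
  `|charge_integral nu f| <=
    M1 * fine (charge_tv nu A) + M2 * fine (charge_tv nu (~` A)).
Proof.
move=> mA /continuous_halfline_measurable mf f1 f2.
have mAC := measurableC mA.
rewrite /charge_integral /charge_tv /charge_variation/=.
rewrite !fineD ?fin_num_measure// !mulrDr addrACA.
by rewrite (le_trans (ler_normB _ _))// lerD// normr_Rintegral_le_split.
Qed.

Lemma charge_tv_cvg0 (F : (set (halfline R))^nat) :
  (forall n, measurable (F n)) -> nonincreasing_seq F ->
  measurable (\bigcap_n F n) -> charge_tv nu (\bigcap_n F n) = 0%E ->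
  fine (charge_tv nu (F n)) @[n --> \oo] --> 0.
Proof.
move=> mF niF mI I0.
pose mu := charge_variation (svalP (hahn_of nu)).
have : mu \o F @ \oo --> mu (\bigcap_n F n).
  by apply: nonincreasing_cvg_mu => //; rewrite ltey_eq fin_num_measure.
by rewrite -[X in _ --> X]/(charge_tv nu _) I0 => /fine_cvgP[].
Qed.

End charges.

Lemma ler_norm_coord (R : realType) m (v : 'cV[R]_m) i : `|v i 0| <= `|v|.
Proof.
rewrite [leRHS]/Num.norm/= mx_normrE.
by rewrite (le_bigmax _ (fun ij => `|v ij.1 ij.2|) (i, 0)).
Qed.

Lemma cV_norm_le (R : realType) m (v : 'cV[R]_m) (M : R) :
  0 <= M -> (forall i, `|v i 0| <= M) -> `|v| <= M.
Proof.
move=> M0 vM; rewrite [leLHS]/Num.norm/= mx_normrE.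
by apply/bigmax_leP; split=> // -[i j] _ /=; rewrite ord1.
Qed.

(** * Functions on the half-line and the smallness of [nu] near 0 and near minus infinity *)

Section history_space_BU.
Context {R : realType} {m : nat}.
Local Notation V := 'cV[R]_m.
Local Notation BU := (BU R m).

Lemma half_val_inj (s t : halfline R) : half_val s = half_val t -> s = t.
Proof. exact: val_inj. Qed.

Lemma half_val_continuous : continuous (@half_val R).
Proof. exact: (@initial_continuous _ _ set_val). Qed.

(** Retraction of the line onto the half-line; composing [x] with it continues [x] to positive times
    by the constant [x(0)]. *)
Definition half_clamp (t : R) : halfline R :=
  Defs.half (t := Num.min 0 t) ltac:(by rewrite ge_min lexx).

Lemma half_clampE (t : R) : t <= 0 -> half_val (half_clamp t) = t.
Proof. by move=> t0; apply/min_idPr. Qed.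

Lemma half_clampK (s : halfline R) : half_clamp (half_val s) = s.
Proof. by apply: half_val_inj; rewrite half_clampE ?half_le0. Qed.

Lemma half_clamp_dist (s t : R) :
  `|half_val (half_clamp s) - half_val (half_clamp t)| <= `|s - t|.
Proof.
rewrite -[half_val (half_clamp s)]/(Num.min 0 s).
rewrite -[half_val (half_clamp t)]/(Num.min 0 t).
have [s0|s0] := leP 0 s; have [t0|t0] := leP 0 t.
- by rewrite subrr normr0.
- by rewrite sub0r normrN ltr0_norm// ger0_norm; lra.
- by rewrite subr0 ltr0_norm// ler0_norm; lra.
- by [].
Qed.

Lemma BU_clamp_continuous (x : BU) : continuous (fun t => x (half_clamp t)).
Proof.
move=> t; apply/cvgrPdist_lt => e e0.
have /BU_predP[_ /(_ e e0)[d d0 hd]] := valP x.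
exists d => //= s st; apply: hd.
exact: le_lt_trans (half_clamp_dist _ _) st.
Qed.

Lemma BU_continuous (x : BU) : continuous x.
Proof.
move=> s.
have := @continuous_comp _ _ _ (@half_val R) (fun t => x (half_clamp t)) s
  (@half_val_continuous s) (@BU_clamp_continuous x _).
by rewrite (_ : _ \o _ = x)//; apply/funext => t /=; rewrite half_clampK.
Qed.

Lemma BU_coord_continuous (x : BU) j : continuous (fun s => x s j 0).
Proof.
move=> s; apply: (@continuous_comp _ _ _ x (fun v : V => v j 0)).
  exact: BU_continuous.
exact: coord_continuous.
Qed.

Lemma measurable_half_val_lt (c : R) :
  measurable [set s : halfline R | half_val s < c].
Proof.
have := continuous_halfline_measurable half_val_continuous.
move=> /(_ measurableT `]-oo, c[%classic (measurable_itv _)).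
by rewrite setTI; congr measurable; apply/seteqP; split=> s /=; rewrite in_itv.
Qed.

Lemma measurable_half_val_gt (c : R) :
  measurable [set s : halfline R | c < half_val s].
Proof.
have := continuous_halfline_measurable half_val_continuous.
move=> /(_ measurableT `]c, +oo[%classic (measurable_itv _)).
by rewrite setTI; congr measurable; apply/seteqP; split=> s /=;
  rewrite in_itv/= andbT.
Qed.

Variable nu : 'I_m -> 'I_m -> {charge set (halfline R) -> \bar R}.

(** Cruder than the largest row sum that suits the maximum norm, but limits pass directly through
    the finite sums. *)
Definition mx_tv (A : set (halfline R)) : R :=
  \sum_i \sum_j fine (charge_tv (nu i j) A).

Lemma charge_tv_ge0 i j A : 0 <= fine (charge_tv (nu i j) A).
Proof. by rewrite fine_ge0// adde_ge0. Qed.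

Lemma mx_tv_ge0 A : 0 <= mx_tv A.
Proof. by do 2 (apply: sumr_ge0 => ? _); exact: charge_tv_ge0. Qed.

Lemma mx_integral_le (x : BU) (A : set (halfline R)) (M1 M2 : R) :
  measurable A -> 0 <= M1 -> 0 <= M2 ->
  (forall s, A s -> `|x s| <= M1) -> (forall s, ~ A s -> `|x s| <= M2) ->
  `|mx_integral nu x| <= M1 * mx_tv A + M2 * mx_tv (~` A).
Proof.
move=> mA M10 M20 x1 x2.
apply: cV_norm_le => [|i]; first by rewrite addr_ge0// mulr_ge0// mx_tv_ge0.
rewrite mxE; pose t B := \sum_j fine (charge_tv (nu i j) B).
have t_le B : t B <= mx_tv B.
  rewrite /mx_tv (bigD1 i)//= lerDl; apply: sumr_ge0 => k _.
  by apply: sumr_ge0 => j _; exact: charge_tv_ge0.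
apply: (@le_trans _ _ (M1 * t A + M2 * t (~` A))); last first.
  by rewrite lerD// ler_wpM2l.
rewrite /t !mulr_sumr -big_split/=; apply: (le_trans (ler_norm_sum _ _ _)).
apply: ler_sum => j _; apply: normr_charge_integral_le => //.
- exact: BU_coord_continuous.
- by move=> s /x1; apply: le_trans; exact: ler_norm_coord.
- by move=> s /x2; apply: le_trans; exact: ler_norm_coord.
Qed.

Lemma mx_tv_cvg0 (F : (set (halfline R))^nat) :
  (forall n, measurable (F n)) -> nonincreasing_seq F ->
  measurable (\bigcap_n F n) ->
  (forall i j, charge_tv (nu i j) (\bigcap_n F n) = 0%E) ->
  forall e, 0 < e -> exists n, mx_tv (F n) <= e.
Proof.
move=> mF niF mI I0 e e0.
have : mx_tv (F n) @[n --> \oo] --> \sum_(i < m) \sum_(j < m) (0 : R).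
  apply: cvg_big => [|i _]; first exact: add_continuous.
  by apply: cvg_big => [|j _]; [exact: add_continuous|exact: charge_tv_cvg0].
rewrite big1 => [|i _]; last by rewrite big1.
move=> /cvgr0Pnorm_le /(_ e e0)[n _ /(_ n (leqnn n))] /= hn.
by exists n; rewrite (le_trans (ler_norm _)).
Qed.

(** The intervals [(-1/(n+1), 0]] shrink to the point 0, which has no mass, so their total variation
    tends to 0; a function supported in such an interval sees only this mass. *)
Lemma mx_integral_near0 :
  (forall i j, charge_tv (nu i j) [set half0 R] = 0%E) ->
  forall e, 0 < e -> exists2 a : R, 0 < a & forall x : BU,
    (forall s, half_val s <= - a -> x s = 0) -> `|mx_integral nu x| <= e * `|x|.
Proof.
move=> nu0 e e0.
pose F n := [set s : halfline R | - n.+1%:R^-1 < half_val s].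
have FI : \bigcap_n F n = [set half0 R].
  apply/seteqP; split => [s sF|_ -> n _]; last by rewrite /F/= oppr_lt0.
  apply: half_val_inj; apply/eqP; rewrite eq_le half_le0/= leNgt.
  apply/negP => s0.
  have s0' : 0 < - half_val s by rewrite oppr_gt0.
  have [n _ /(_ n (leqnn n)) /= hn] := near_infty_natSinv_lt (PosNum s0').
  by have := sF n I; rewrite /F/= ltrNl ltNge (ltW hn).
have [n nF] : exists n, mx_tv (F n) <= e.
  apply: mx_tv_cvg0 => //; rewrite ?FI//.
  - by move=> n; exact: measurable_half_val_gt.
  - move=> n k nk; apply/subsetPset => s; apply: le_lt_trans.
    by rewrite lerN2 lef_pV2 ?posrE// ler_nat.
  - rewrite (_ : [set half0 R] = ~` [set s | half_val s < 0]).
      by apply: measurableC; exact: measurable_half_val_lt.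
    apply/seteqP; split => [s -> /=|s /negP]; first by rewrite /half0 ltxx.
    rewrite -leNgt => s0; apply: half_val_inj; apply/eqP.
    by rewrite eq_le half_le0.
exists n.+1%:R^-1 => // x x0.
have mF : measurable (F n) by exact: measurable_half_val_gt.
have := @mx_integral_le x (F n) `|x| 0 mF.
rewrite mul0r addr0 => /(_ (normr_ge0 _) (lexx _)) h.
rewrite (le_trans (h _ _))//.
- by move=> s _; exact: ler_bu_norm.
- by move=> s /negP; rewrite -leNgt => /x0 ->; rewrite normr0.
- by rewrite mulrC ler_wpM2r.
Qed.

(** The half-lines [(-oo, -n)] decrease to the empty set, so their total variation falls below [e].
    This is the source of the continuity of [D] under locally uniform convergence of bounded
    sequences. *)
Lemma mx_integral_tail (e : R) : 0 < e ->
  exists n : nat, exists2 C : R, 0 <= C & forall (x : BU) (d : R), 0 <= d ->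
    (forall s, - n%:R <= half_val s -> `|x s| <= d) ->
    `|mx_integral nu x| <= C * d + e * `|x|.
Proof.
move=> e0; pose F n := [set s : halfline R | half_val s < - n%:R].
have FI : \bigcap_n F n = set0.
  apply/seteqP; split => // s sF.
  have := sF (Num.truncn (- half_val s)).+1 I; rewrite /F/= ltrNr => /ltW.
  by rewrite leNgt truncnS_gt.
have mF n : measurable (F n) by exact: measurable_half_val_lt.
have tv0 i j : charge_tv (nu i j) set0 = 0%E.
  by rewrite /charge_tv /charge_variation/= !measure0 adde0.
have [n nF] : exists n, mx_tv (F n) <= e.
  apply: mx_tv_cvg0; rewrite ?FI//.
  move=> n k nk; apply/subsetPset => s /=; rewrite /F/= => h.
  by rewrite (lt_le_trans h)// lerN2 ler_nat.
exists n, (mx_tv (~` F n)); first exact: mx_tv_ge0.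
move=> x d d0 xd; rewrite addrC.
rewrite (le_trans (mx_integral_le (mF n) (normr_ge0 x) d0 _ _))//.
- by move=> s _; exact: ler_bu_norm.
- by move=> s /negP; rewrite -leNgt; exact: xd.
- by rewrite lerD// mulrC// ler_wpM2r.
Qed.

End history_space_BU.

(** * Translations, cut-offs and locally uniform limits in [BU] *)

Section BU_operations.
Context {R : realType} {m : nat}.
Local Notation V := 'cV[R]_m.
Local Notation BU := (BU R m).

Lemma BU_norm_le (x : BU) M : (forall s, `|x s| <= M) -> `|x| <= M.
Proof. exact: bu_norm_le. Qed.

Lemma BU_norm_ge (x : BU) s : `|x s| <= `|x|.
Proof. exact: ler_bu_norm. Qed.

Lemma BU_eqP (x y : BU) : (forall s, x s = y s) -> x = y.
Proof. by move=> xy; apply/val_inj/funext. Qed.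

Lemma BU_addE (x y : BU) s : (x + y) s = x s + y s.
Proof. by []. Qed.

Lemma BU_subE (x y : BU) s : (x - y) s = x s - y s.
Proof. by []. Qed.

Lemma BU_shiftE (x : BU) t s : BU_shift x t s = x (half_add t s).
Proof. by []. Qed.

Lemma BU_shiftD (x y : BU) t : BU_shift (x + y) t = BU_shift x t + BU_shift y t.
Proof. exact: BU_eqP. Qed.

Lemma BU_shiftB (x y : BU) t : BU_shift (x - y) t = BU_shift x t - BU_shift y t.
Proof. exact: BU_eqP. Qed.

Lemma BU_shift0 (x : BU) : BU_shift x (half0 R) = x.
Proof.
by apply: BU_eqP => s; rewrite BU_shiftE; congr (x _); apply: half_val_inj;
  rewrite half_addE add0r.
Qed.

Lemma half_addC (s t : halfline R) : half_add s t = half_add t s.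
Proof. by apply: half_val_inj; rewrite !half_addE addrC. Qed.

Lemma half_addA (s t u : halfline R) :
  half_add s (half_add t u) = half_add (half_add s t) u.
Proof. by apply: half_val_inj; rewrite !half_addE addrA. Qed.

Lemma half_add0 (s : halfline R) : half_add s (half0 R) = s.
Proof. by apply: half_val_inj; rewrite half_addE addr0. Qed.

Lemma half_subP (s t : halfline R) : half_val s <= half_val t ->
  exists2 r, s = half_add r t & half_val r = half_val s - half_val t.
Proof.
move=> st; have st0 : half_val s - half_val t <= 0 by rewrite subr_le0.
by exists (Defs.half st0) => //; apply: half_val_inj; rewrite half_addE subrK.
Qed.

Lemma BU_norm_shift (x : BU) t : `|BU_shift x t| <= `|x|.
Proof. by apply: BU_norm_le => s; exact: (BU_norm_ge x (half_add t s)). Qed.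

(** Together with its converse [BU_osc_shift], this expresses a modulus of continuity through norms
    of [BU_shift x r - x]. As [Dhat] commutes with translations, norm estimates for [Dhat] then
    carry moduli of continuity over. *)
Lemma BU_shift_osc (x : BU) (e d : R) :
  (forall s t, `|half_val s - half_val t| < d -> `|x s - x t| <= e) ->
  forall r, - d < half_val r -> `|BU_shift x r - x| <= e.
Proof.
move=> xd r rd; apply: BU_norm_le => s; apply: xd.
by rewrite half_addE addrK ler0_norm ?half_le0// ltrNl.
Qed.

Lemma BU_osc_shift (x : BU) (e d : R) :
  (forall r, - d < half_val r -> `|BU_shift x r - x| <= e) ->
  forall s t, `|half_val s - half_val t| < d -> `|x s - x t| <= e.
Proof.
move=> xd s t; wlog st : s t / half_val s <= half_val t => [h|].
  have [/h//|/ltW ts] := leP (half_val s) (half_val t).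
  by rewrite distrC (distrC (x s)); exact: h.
have [r -> rE] := half_subP st; rewrite half_addE addrK => rd.
have /xd : - d < half_val r by rewrite ltrNl -ler0_norm ?half_le0.
exact: le_trans (BU_norm_ge (BU_shift x r - x) t).
Qed.

Lemma BU_advance_subproof (a : R) (x : BU) :
  (fun s => x (half_clamp (half_val s + a))) \in @BU_pred R m.
Proof.
have /BU_predP[[M xM] ux] := valP x.
apply/BU_predP; split; first by exists M => s; exact: xM.
move=> e /ux[d d0 xd]; exists d => // s t st; apply: xd.
rewrite (le_lt_trans (half_clamp_dist _ _))//.
by rewrite opprD addrACA subrr addr0.
Qed.

(** For [a >= 0], translation to the right by [a], with the interval [[-a, 0]] filled by the
    constant [x(0)]. *)
Definition BU_advance (a : R) (x : BU) : BU :=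
  MkBU (BU_advance_subproof a x).

Lemma BU_shift_advance (a : R) (x : BU) (t : halfline R) :
  half_val t = - a -> BU_shift (BU_advance a x) t = x.
Proof.
move=> ta; apply: BU_eqP => s; rewrite -[LHS]/(x (half_clamp _)).
by rewrite half_addE ta addrAC addNr add0r half_clampK.
Qed.

Lemma BU_norm_advance (a : R) (x : BU) : `|BU_advance a x| <= `|x|.
Proof.
by apply: BU_norm_le => s; exact: (BU_norm_ge x (half_clamp (half_val s + a))).
Qed.

(* 1-Lipschitz, so that the cut-offs of a fixed h form an equicontinuous family. *)
Definition cutoff (b t : R) : R := Num.min 1 (Num.max 0 (t + b + 1)).

Lemma cutoff_ge0 b t : 0 <= cutoff b t.
Proof. by rewrite le_min ler01 le_max lexx. Qed.

Lemma cutoff_le1 b t : cutoff b t <= 1.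
Proof. by rewrite ge_min lexx. Qed.

Lemma cutoff_eq1 b t : - b <= t -> cutoff b t = 1.
Proof. by move=> bt; apply/min_idPl; rewrite le_max; apply/orP; right; lra. Qed.

Lemma cutoff_eq0 b t : t <= - (b + 1) -> cutoff b t = 0.
Proof.
by move=> bt; rewrite /cutoff max_l; [rewrite min_r//|]; lra.
Qed.

Lemma cutoff_lip b s t : `|cutoff b s - cutoff b t| <= `|s - t|.
Proof.
wlog st : s t / s <= t => [h|].
  have [/h//|/ltW ts] := leP s t.
  by rewrite distrC (distrC s); exact: h.
rewrite [leRHS]distrC (ger0_norm (x := t - s)) ?subr_ge0//.
rewrite ler_norml /cutoff !minEle !maxEle.
by case: (leP 0 (s + b + 1)) => ?; case: (leP 0 (t + b + 1)) => ?;
  do ?[case: (leP 1 _) => ?]; apply/andP; split; lra.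
Qed.

Lemma BU_cut_lip (b : R) (x : BU) s t :
  `|cutoff b (half_val s) *: x s - cutoff b (half_val t) *: x t| <=
  `|x s - x t| + `|x| * `|half_val s - half_val t|.
Proof.
have -> : cutoff b (half_val s) *: x s - cutoff b (half_val t) *: x t =
    cutoff b (half_val s) *: (x s - x t) +
    (cutoff b (half_val s) - cutoff b (half_val t)) *: x t.
  by rewrite scalerBr scalerBl addrA subrK.
rewrite (le_trans (ler_normD _ _))// lerD// normrZ.
  by rewrite ger0_norm ?cutoff_ge0// ler_piMl// cutoff_le1.
by rewrite mulrC ler_pM// ?BU_norm_ge// cutoff_lip.
Qed.

Lemma BU_cut_subproof (b : R) (x : BU) :
  (fun s => cutoff b (half_val s) *: x s) \in @BU_pred R m.
Proof.
have /BU_predP[_ ux] := valP x.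
apply/BU_predP; split.
  exists `|x| => s; rewrite normrZ ger0_norm ?cutoff_ge0//.
  by rewrite (le_trans _ (BU_norm_ge x s))// ler_piMl// cutoff_le1.
move=> e e0; have [d d0 xd] := ux (e / 2) ltac:(by rewrite divr_gt0).
have x0 : 0 < `|x| + 1 by rewrite ltr_wpDl.
exists (Num.min d (e / 2 / (`|x| + 1))).
  by rewrite lt_min d0/= !divr_gt0.
move=> s t; rewrite lt_min => /andP[/xd h1 h2].
rewrite (le_lt_trans (BU_cut_lip _ _ _ _))// (splitr e) ltr_leD//.
move: h2; rewrite ltr_pdivlMr// => /ltW; apply: le_trans.
by rewrite mulrC ler_wpM2l// lerDl.
Qed.

Definition BU_cut (b : R) (x : BU) : BU := MkBU (BU_cut_subproof b x).

Lemma BU_cutE b x s : BU_cut b x s = cutoff b (half_val s) *: x s.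
Proof. by []. Qed.

Lemma BU_cut_id b x s : - b <= half_val s -> BU_cut b x s = x s.
Proof. by move=> bs; rewrite BU_cutE cutoff_eq1// scale1r. Qed.

Lemma BU_cut_eq0 b x s : half_val s <= - (b + 1) -> BU_cut b x s = 0.
Proof. by move=> bs; rewrite BU_cutE cutoff_eq0// scale0r. Qed.

Lemma BU_cut_le b x s : `|BU_cut b x s| <= `|x s|.
Proof.
by rewrite BU_cutE normrZ ger0_norm ?cutoff_ge0// ler_piMl// cutoff_le1.
Qed.

Lemma geometric_small (c e : R) : 0 < e ->
  exists n0, forall n, (n0 <= n)%N -> 2^-1 ^+ n * c <= e.
Proof.
move=> e0; have : 2^-1 ^+ n * c @[n --> \oo] --> 0.
  rewrite -(mul0r c); apply: cvgMl; apply: cvg_expr.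
  by rewrite ger0_norm// invf_lt1// ltr1n.
move=> /cvgr0Pnorm_le /(_ e e0)[n0 _ hn]; exists n0 => n /hn /=.
exact: le_trans (ler_norm _).
Qed.

(** The common bound and the common modulus of continuity pass to the pointwise limit and put it in
    [BU]; the Cauchy condition is only locally uniform, and so is the convergence. *)
Lemma BU_limit (u : nat -> BU) (M : R) :
  (forall n, `|u n| <= M) ->
  (forall e : R, 0 < e -> exists2 d : R, 0 < d & forall n s t,
     `|half_val s - half_val t| < d -> `|u n s - u n t| <= e) ->
  (forall b e : R, 0 < e -> exists n0, forall n p, (n0 <= n)%N -> (n0 <= p)%N ->
     forall s, - b <= half_val s -> `|u n s - u p s| <= e) ->
  exists2 x : BU, `|x| <= M &
    forall b e : R, 0 < e -> exists n0, forall n, (n0 <= n)%N ->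
      forall s, - b <= half_val s -> `|u n s - x s| <= e.
Proof.
move=> uM ueq uC.
have u_cvg s : cvgn (fun n => u n s).
  apply/cauchy_cvgP/cauchy_ballP => e e0.
  have [n0 hn] := uC (- half_val s) (e / 2) ltac:(by rewrite divr_gt0).
  pose tl := [set v : V | exists2 n, (n0 <= n)%N & v = u n s].
  exists (tl, tl) => [|[_ _] [/= [p n0p ->] [q n0q ->]]].
    by split; exists n0 => // n nn0; exists n.
  rewrite /= -ball_normE /=.
  apply: (@le_lt_trans _ _ (e / 2)); last first.
    by rewrite ltr_pdivrMr// ltr_pMr// ltr1n.
  by apply: hn; rewrite ?opprK.
pose x s : V := limn (fun n => u n s).
have u_near s e : 0 < e ->
    exists n0, forall n, (n0 <= n)%N -> `|u n s - x s| <= e.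
  move=> e0; have /cvgrPdist_le /(_ e e0)[n0 _ hn] := u_cvg s.
  by exists n0 => n /hn; rewrite distrC.
(* Closed balls are closed: this one fact gives the bound on [x], its modulus of continuity and the
   rate of convergence. *)
have x_le s v c : (exists n0, forall n, (n0 <= n)%N -> `|v - u n s| <= c) ->
    `|v - x s| <= c.
  move=> [n0 hn]; apply/ler_addgt0Pr => e /(u_near s)[n1 hn1].
  rewrite -(subrK (u (maxn n0 n1) s) v) -addrA (le_trans (ler_normD _ _))//.
  by rewrite lerD// ?hn ?hn1 ?leq_maxl ?leq_maxr.
have x_bd s : `|x s| <= M.
  rewrite -normrN -sub0r; apply: x_le; exists 0%N => n _.
  by rewrite sub0r normrN (le_trans (BU_norm_ge _ _)).
have xBU : x \in @BU_pred R m.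
  apply/BU_predP; split; first by exists M.
  move=> e e0; have [d d0 hd] := ueq (e / 2) ltac:(by rewrite divr_gt0).
  exists d => // s t st; apply: (@le_lt_trans _ _ (e / 2)); last first.
    by rewrite ltr_pdivrMr// ltr_pMr// ltr1n.
  apply/ler_addgt0Pr => r r0.
  apply: x_le.
  have [n0 hn0] := u_near s r r0.
  exists n0 => n nn0.
  rewrite -(subrK (u n s) (x s)) -addrA (le_trans (ler_normD _ _))//.
  by rewrite [leRHS]addrC lerD ?hd// distrC hn0.
exists (MkBU xBU); first exact: BU_norm_le.
move=> b e e0; have [n0 hn] := uC b e e0; exists n0 => n nn0 s bs.
by apply: x_le; exists n0 => p pn0; exact: hn.
Qed.

End BU_operations.

(** * The operator [T]: translations, boundedness and passage to the limit *)

Section Dhat_inverse.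
Context {R : realType} {m : nat}.
Local Notation V := 'cV[R]_m.
Local Notation BU := (BU R m).
Variables (D : {linear BU -> V}) (D1 : continuous D).
Local Notation T := (Dhat D1).

Lemma DhatE x s : T x s = D (BU_shift x s).
Proof. by []. Qed.

Lemma DhatD x y : T (x + y) = T x + T y.
Proof. by apply: BU_eqP => s; rewrite BU_addE !DhatE BU_shiftD linearD. Qed.

Lemma DhatB x y : T (x - y) = T x - T y.
Proof. by apply: BU_eqP => s; rewrite BU_subE !DhatE BU_shiftB linearB. Qed.

Lemma Dhat_shift x t : T (BU_shift x t) = BU_shift (T x) t.
Proof.
apply: BU_eqP => s; rewrite BU_shiftE !DhatE; congr (D _).
by apply: BU_eqP => r; rewrite !BU_shiftE half_addA.
Qed.

Lemma Dhat_half0 x : T x (half0 R) = D x.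
Proof. by rewrite DhatE BU_shift0. Qed.

Lemma Dhat_bounded : exists2 C : R, 0 <= C & forall x, `|T x| <= C * `|x|.
Proof.
have /linear_boundedP[M [_ hM]] := continuous_linear_bounded 0 (@D1 0).
exists (`|M| + 1) => [|x]; first by rewrite addr_ge0.
apply: BU_norm_le => s; rewrite DhatE.
have DM y : `|D y| <= (`|M| + 1) * `|y|.
  by apply: hM; rewrite (le_lt_trans (ler_norm _))// ltrDl.
by rewrite (le_trans (DM _))// ler_wpM2l ?BU_norm_shift ?addr_ge0.
Qed.

Hypothesis D_tail : forall e : R, 0 < e ->
  exists n : nat, exists2 C : R, 0 <= C & forall (x : BU) (d : R), 0 <= d ->
    (forall s, - n%:R <= half_val s -> `|x s| <= d) ->
    `|D x| <= C * d + e * `|x|.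

(** By [D_tail], locally uniform convergence and the bound [M] force [T (u n)] to converge pointwise
    to [T x]; since it also converges to [h], the two agree. *)
Lemma Dhat_limit (u : nat -> BU) (h : BU) (M : R) :
  (forall n, `|u n| <= M) ->
  (forall e : R, 0 < e -> exists2 d : R, 0 < d & forall n s t,
     `|half_val s - half_val t| < d -> `|u n s - u n t| <= e) ->
  (forall b e : R, 0 < e -> exists n0, forall n p, (n0 <= n)%N -> (n0 <= p)%N ->
     forall s, - b <= half_val s -> `|u n s - u p s| <= e) ->
  (forall s (e : R), 0 < e -> exists n0, forall n, (n0 <= n)%N ->
     `|T (u n) s - h s| <= e) ->
  exists x : BU, [/\ `|x| <= M, T x = h &
    forall s (e : R), 0 < e -> exists n0, forall n, (n0 <= n)%N ->
      `|u n s - x s| <= e].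
Proof.
move=> uM ueq uC uh; have [x xM ux] := BU_limit uM ueq uC.
exists x; split=> //; last first.
  move=> s e e0; have [n0 hn] := ux (- half_val s) e e0.
  by exists n0 => n nn0; apply: hn; rewrite ?opprK.
have M0 : 0 <= M by rewrite (le_trans (normr_ge0 x)).
apply: BU_eqP => s; apply/subr0_eq/normr0_eq0/eqP.
rewrite eq_le normr_ge0 andbT; apply/ler_addgt0Pr => e e0; rewrite add0r.
(* [M + M] bounds [|u n - x|], so the tail of [D] contributes at most [e / 3]; adding 1 only keeps
   the divisor positive. *)
have M1 : 0 < M + M + 1 by rewrite ltr_wpDl// addr_ge0.
have e'0 : 0 < e / 3 / (M + M + 1) by rewrite !divr_gt0.
have [b [C C0 DC]] := D_tail e'0.
have C1 : 0 < C + 1 by rewrite ltr_wpDl.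
have d0 : 0 < e / 3 / (C + 1) by rewrite !divr_gt0.
(* The part of the history at [s] that lies in [[-b, 0]] uses values on [[s - b, s]]. *)
have [n0 hn0] := ux (b%:R - half_val s) _ d0.
have [n1 hn1] := uh s (e / 3) ltac:(by rewrite divr_gt0).
pose n := maxn n0 n1.
have h1 : `|T (u n) s - h s| <= e / 3 by apply: hn1; exact: leq_maxr.
have h2 : `|T (u n) s - T x s| <= e / 3 + e / 3.
  rewrite -BU_subE -DhatB DhatE (le_trans (DC _ _ (ltW d0) _))//.
    move=> r rb; rewrite BU_shiftE; apply: hn0; first exact: leq_maxl.
    by rewrite opprB half_addE lerD2l.
  rewrite lerD//.
    rewrite mulrCA; apply: ler_piMr; first by rewrite divr_ge0// ltW.
    by rewrite ler_pdivrMr// mul1r lerDl.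
  rewrite mulrAC ler_pdivrMr//; apply: ler_wpM2l.
    by rewrite divr_ge0// ltW.
  rewrite (le_trans (BU_norm_shift _ _))// (le_trans (ler_normB _ _))//.
  by rewrite (le_trans (lerD (uM n) xM))// lerDl.
rewrite -(subrK (T (u n) s) (T x s)) -addrA (le_trans (ler_normD _ _))//.
by rewrite distrC (le_trans (lerD h2 h1))//; lra.
Qed.

(** * Inversion of [T] on functions supported near 0 *)

Variables (a : R) (a_gt0 : 0 < a).
Hypothesis D_near0 : forall x : BU, (forall s, half_val s <= - a -> x s = 0) ->
  `|x (half0 R) - D x| <= 2^-1 * `|x|.

(** The translate of [x] by [s <= 0] still vanishes on [(-oo, -a]], so the bound at 0 applies to
    every history of [x]. *)
Lemma Dhat_contraction (x : BU) : (forall s, half_val s <= - a -> x s = 0) ->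
  `|x - T x| <= 2^-1 * `|x|.
Proof.
move=> x0; apply: BU_norm_le => s; rewrite BU_subE DhatE.
have -> : x s = BU_shift x s (half0 R) by rewrite BU_shiftE half_add0.
apply: (le_trans (D_near0 _)) => [r ra|]; last first.
  by rewrite ler_wpM2l ?BU_norm_shift.
by rewrite BU_shiftE x0// half_addE (le_trans _ ra)// gerDr half_le0.
Qed.

Lemma Dhat_eq0 (b : R) (x : BU) : (forall s, half_val s <= - b -> x s = 0) ->
  forall s, half_val s <= - b -> T x s = 0.
Proof.
move=> x0 s sb; rewrite DhatE (_ : BU_shift x s = 0) ?linear0//.
apply: BU_eqP => r; rewrite BU_shiftE x0// half_addE.
by rewrite (le_trans _ sb)// gerDl half_le0.
Qed.

Section successive_approximations.
Variable g : BU.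
Hypothesis g0 : forall s, half_val s <= - a -> g s = 0.

(** Partial sums of the Neumann series for the inverse of [T = I - (I - T)], applied to [g]. *)
Let v k : BU := iter k (fun w => g + (w - T w)) 0.

Let vS k : v k.+1 = g + (v k - T (v k)). Proof. by []. Qed.

Let v_eq0 k s : half_val s <= - a -> v k s = 0.
Proof.
elim: k s => [//|k IH] s sa; rewrite vS BU_addE BU_subE g0// IH//.
by rewrite (Dhat_eq0 IH)// subr0 addr0.
Qed.

Let v_le k : `|v k| <= 2 * `|g|.
Proof.
elim: k => [|k IH]; first by rewrite /v/= normr0 mulr_ge0.
rewrite vS (le_trans (ler_normD _ _))//.
have := @Dhat_contraction (v k) (@v_eq0 k); lra.
Qed.

Let v_geometric n p : `|v (n + p)%N - v n| <= 2^-1 ^+ n * (2 * `|g|).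
Proof.
elim: n => [|n IH]; first by rewrite add0n subr0 expr0 mul1r.
have -> : v (n.+1 + p)%N - v n.+1 =
    (v (n + p)%N - v n) - T (v (n + p)%N - v n).
  rewrite addSn !vS DhatB opprD addrACA subrr add0r.
  by rewrite [in LHS]opprD addrACA -opprD.
rewrite (le_trans (Dhat_contraction _))//.
  by move=> s sa; rewrite BU_subE !v_eq0// subrr.
by rewrite exprS -mulrA ler_wpM2l.
Qed.

(** Since [T] commutes with translations, [BU_shift (v k) r - v k] obeys the recursion of [v] with
    [BU_shift g r - g] in place of [g], and the argument of [v_le] applies. The iterates thus share
    a modulus of continuity. *)
Let v_shift r k : `|BU_shift (v k) r - v k| <= 2 * `|BU_shift g r - g|.
Proof.
elim: k => [|k IH].
  rewrite (_ : BU_shift (v 0%N) r - v 0%N = 0) ?normr0 ?mulr_ge0//.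
  by apply: BU_eqP => s; rewrite BU_subE BU_shiftE subrr.
set w := BU_shift (v k) r - v k in IH.
have -> : BU_shift (v k.+1) r - v k.+1 = (BU_shift g r - g) + (w - T w).
  rewrite vS BU_shiftD BU_shiftB -Dhat_shift /w DhatB.
  by rewrite opprD addrACA; congr (_ + _); rewrite [in LHS]opprD addrACA -opprD.
rewrite (le_trans (ler_normD _ _))//.
have : `|w - T w| <= 2^-1 * `|w|.
  apply: Dhat_contraction => s sa; rewrite BU_subE BU_shiftE !v_eq0 ?subrr//.
  by rewrite half_addE (le_trans _ sa)// gerDr half_le0.
lra.
Qed.

Lemma Dhat_solve_near0 : exists u : BU,
  [/\ forall s, half_val s <= - a -> u s = 0, T u = g & `|u| <= 2 * `|g|].
Proof.
have [||||u [uM Tu ucvg]] := @Dhat_limit v g (2 * `|g|).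
- exact: v_le.
- move=> e e0; have e2 : 0 < e / 2 by rewrite divr_gt0.
  have /BU_predP[_ /(_ _ e2)[d d0 gd]] := valP g.
  exists d => // n; apply: BU_osc_shift => r rd.
  apply: (le_trans (v_shift r n)); rewrite -ler_pdivlMl// mulrC.
  by apply: BU_shift_osc rd => s t /gd/ltW.
- move=> b e e0; have e2 : 0 < e / 2 by rewrite divr_gt0.
  have [n0 hn0] := geometric_small (2 * `|g|) e2.
  have hn n s : (n0 <= n)%N -> `|v n s - v n0 s| <= e / 2.
    move=> nn0; rewrite -(subnKC nn0) (le_trans (BU_norm_ge (_ - _) s))//.
    exact: le_trans (v_geometric _ _) (hn0 _ _).
  exists n0 => n p nn0 pn0 s _.
  rewrite -(subrK (v n0 s) (v n s)) -addrA (le_trans (ler_normD _ _))//.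
  by rewrite (splitr e) lerD ?hn// distrC hn.
(* The residual [T (v n) - g] equals [v n - v n.+1], which is covered by [v_geometric] with
   [p = 1]. *)
- move=> s e e0; have [n0 hn0] := @geometric_small R (2 * `|g|) e e0.
  exists n0 => n /hn0; apply: le_trans; apply: le_trans (v_geometric n 1).
  rewrite addn1 vS [v n - _]addrC addrA addrK -BU_subE.
  by rewrite (le_trans (BU_norm_ge (T (v n) - g) s))// -normrN opprB.
exists u; split=> // s sa; apply/eqP; rewrite -normr_le0.
apply/ler_addgt0Pr => e e0; rewrite add0r.
have [n0 /(_ n0 (leqnn _))] := ucvg s e e0.
by rewrite v_eq0// sub0r normrN.
Qed.

End successive_approximations.

(** * Solving by steps of length [a] *)

Let step : halfline R := half_clamp (- a).

Let step_val : half_val step = - a.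
Proof. by rewrite half_clampE// oppr_le0 ltW. Qed.

(* x is the constant continuation of phi plus the solution of a problem whose
   right-hand side vanishes on (-oo, -a]. *)
Lemma Dhat_extend : exists2 K : R, 0 <= K & forall phi h : BU,
  BU_shift h step = T phi -> exists x : BU,
    [/\ BU_shift x step = phi, T x = h & `|x| <= K * (`|phi| + `|h|)].
Proof.
have [C C0 TC] := Dhat_bounded.
(* The continuation [y] costs [|phi|] and the correction [u] costs [2 (|h| + C |phi|)]; [2 * C + 3]
   dominates both total coefficients. *)
exists (2 * C + 3) => [|phi h hphi]; first by rewrite addr_ge0// mulr_ge0.
pose y := BU_advance a phi.
have yphi : BU_shift y step = phi by exact: BU_shift_advance.
(* Up to time [-a] the histories of [y] are those of [phi], so the compatibility of [h] with [phi]
   makes [h - T y] vanish there. *)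
have [|u [u0 Tu ule]] := @Dhat_solve_near0 (h - T y).
  move=> s; rewrite -step_val => /half_subP[r -> _].
  by rewrite BU_subE half_addC -!BU_shiftE hphi -Dhat_shift yphi subrr.
exists (y + u); split.
- rewrite BU_shiftD yphi (_ : BU_shift u step = 0) ?addr0//.
  apply: BU_eqP => s; rewrite BU_shiftE u0// half_addE step_val.
  by rewrite gerDl half_le0.
- by rewrite DhatD Tu addrC subrK.
- have h1 : `|y| <= `|phi| by exact: BU_norm_advance.
  have h2 : `|h - T y| <= `|h| + C * `|phi|.
    rewrite (le_trans (ler_normB _ _))// lerD//.
    by rewrite (le_trans (TC _))// ler_wpM2l.
  rewrite (le_trans (ler_normD _ _))//.
  have h3 : 0 <= `|phi| by [].
  have h4 : 0 <= C * `|h| by rewrite mulr_ge0.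
  have h5 : 0 <= `|h| by [].
  nra.
Qed.

(** Induction on the number of steps: translated by [-a], the right-hand side vanishes up to one
    step closer to 0 and is solved first; [Dhat_extend] then adds the last interval of length
    [a]. *)
Lemma Dhat_solve_step n : exists2 K : R, 0 <= K & forall g : BU,
  (forall s, half_val s <= - (n%:R * a) -> g s = 0) -> exists u : BU,
    [/\ forall s, half_val s <= - (n%:R * a) -> u s = 0, T u = g &
        `|u| <= K * `|g|].
Proof.
elim: n => [|n [K K0 IH]].
  exists 0 => // g g0; exists g; have -> : g = 0.
    by apply: BU_eqP => s; rewrite g0// mul0r oppr0 half_le0.
  split=> //; last by rewrite mul0r normr0.
  apply: BU_eqP => s; rewrite DhatE (_ : BU_shift 0 s = 0) ?linear0//.
  exact: BU_eqP.
have [L L0 ext] := Dhat_extend.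
exists (L * (K + 1)) => [|g g0]; first by rewrite mulr_ge0// addr_ge0.
have [|u [u0 Tu ule]] := IH (BU_shift g step).
  move=> s sn; rewrite BU_shiftE g0// half_addE step_val.
  by rewrite -natr1 mulrDl mul1r opprD addrC lerD2r.
have [x [xu Tx xle]] := ext u g (esym Tu).
exists x; split=> // [s sn|].
  have : half_val s <= half_val step.
    by rewrite step_val (le_trans sn)// lerN2 ler_peMl ?ler1n// ltW.
  move=> /half_subP[r sE rE]; rewrite sE half_addC -BU_shiftE xu u0//.
  by move: sn; rewrite rE step_val -natr1 mulrDl mul1r; lra.
rewrite (le_trans xle)// -mulrA ler_wpM2l// mulrDl mul1r lerD2r.
by rewrite (le_trans ule)// ler_wpM2l// BU_norm_shift.
Qed.

Lemma Dhat_solve (b : R) : exists2 K : R, 0 <= K & forall g : BU,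
  (forall s, half_val s <= - b -> g s = 0) -> exists2 u : BU,
    T u = g & `|u| <= K * `|g|.
Proof.
pose n := (Num.truncn (`|b| / a)).+1.
have bn : b <= n%:R * a.
  rewrite (le_trans (ler_norm _))// -ler_pdivrMr// ltW//; exact: truncnS_gt.
have [K K0 hK] := Dhat_solve_step n; exists K => // g g0.
have [s sn|u [_ Tu ule]] := hK g; first by rewrite g0// (le_trans sn)// lerN2.
by exists u.
Qed.

(** The right-hand side [BU_advance a (T w)] continues [T w] by the constant [D w = 0]. Choice
    yields a function, so that the continuation can be iterated. *)
Lemma Dhat_extend0 : exists next : BU -> BU, forall w : BU, D w = 0 ->
  BU_shift (next w) step = w /\
  forall s, - a <= half_val s -> T (next w) s = 0.
Proof.
have [K _ ext] := Dhat_extend.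
suff : forall w : BU, exists x : BU, D w = 0 ->
    BU_shift x step = w /\ forall s, - a <= half_val s -> T x s = 0.
  by move=> /choice[next nextP]; exists next.
move=> w; have [|x [xw Tx _]] := ext w (BU_advance a (T w)).
  by rewrite BU_shift_advance.
exists x => w0; split=> // s sa.
rewrite Tx -[LHS]/(T w (half_clamp (half_val s + a))).
rewrite (_ : half_clamp _ = half0 R) ?Dhat_half0//; apply: half_val_inj.
by rewrite -[LHS]/(Num.min 0 (half_val s + a)) min_l//; lra.
Qed.

(** * Continuation to solutions on the whole line *)

Section solution.
Variables (b : R) (w : BU).
Hypotheses (b_ge0 : 0 <= b) (w0 : forall s, - b <= half_val s -> T w s = 0).

(** Time is moved so that [-b] becomes 0: the history of [w] at [-b] is the initial datum, and [w]
    on [[-b, 0]] is the solution on [[0, b]]. Stability concerns solutions for all positive times,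
    whence the continuation beyond [b]. *)
Lemma Dhat_solution_exists : exists x : R -> V,
  is_solution D (BU_shift w (half_clamp (- b))) x /\ x b = w (half0 R).
Proof.
have b0 := b_ge0; have [next nextP] := Dhat_extend0.
(* W k is w continued up to time k * a and translated back to (-oo, 0]. *)
pose W k := iter k next w.
have W0 k s : - (b + k%:R * a) <= half_val s -> T (W k) s = 0.
  elim: k s => [|k IH] s; first by rewrite mul0r addr0; exact: w0.
  have DW : D (W k) = 0.
    by rewrite -Dhat_half0 IH// oppr_le0 addr_ge0// mulr_ge0// ltW.
  have [sW TW] := nextP _ DW => sk.
  have [sa|/ltW sa] := leP (- a) (half_val s); first exact: TW.
  move: sa sk; rewrite -step_val => /half_subP[r -> rE].
  rewrite half_addC half_addE step_val -natr1 mulrDl mul1r => sk.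
  by rewrite -BU_shiftE -Dhat_shift sW IH//; lra.
have sW k : BU_shift (W k.+1) step = W k.
  apply: (nextP _ _).1; rewrite -Dhat_half0 W0//.
  by rewrite oppr_le0 addr_ge0// mulr_ge0// ltW.
(* [W k] moved back to absolute time: faithful for [t <= b + k * a], constant afterwards. *)
pose X k (t : R) := W k (half_clamp (t - (b + k%:R * a))).
have XS k j (t : R) : t <= b + k%:R * a -> X k t = X (k + j)%N t.
  move=> tk; elim: j => [|j IH]; first by rewrite addn0.
  rewrite IH addnS /X -[in LHS]sW BU_shiftE; congr (W _ _).
  apply: half_val_inj; have aj : 0 <= j%:R * a by rewrite mulr_ge0// ltW.
  have ES : (k + j)%N.+1%:R * a = k%:R * a + j%:R * a + a.
    by rewrite -natr1 natrD !mulrDl mul1r.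
  have a0 := a_gt0.
  by rewrite half_addE step_val !half_clampE; rewrite ?ES ?natrD ?mulrDl; lra.
(* Both sides are compared with the function of index [k + l]. *)
have Xeq k l (t : R) : t <= b + k%:R * a -> t <= b + l%:R * a -> X k t = X l t.
  by move=> tk tl; rewrite (XS k l)// (XS l k)// addnC.
pose K (t : R) := (Num.truncn (`|t| / a)).+1.
have KP (t : R) : t <= b + (K t)%:R * a.
  rewrite (le_trans (ler_norm _))// ler_wpDl// -ler_pdivrMr// ltW//.
  exact: truncnS_gt.
pose x (t : R) := X (K t) t.
have xX k (t : R) : t <= b + k%:R * a -> x t = X k t by move=> tk; exact: Xeq.
exists x; split; last first.
  rewrite (xX 0%N) ?mul0r ?addr0// /X mul0r addr0 subrr.
  by congr (w _); apply: half_val_inj; rewrite half_clampE.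
split.
(* The index belongs to time [t + 1], so that a single [X k] represents [x] on a neighbourhood of
   [t]. *)
- move=> t; rewrite /continuous_at; pose k := K (t + 1).
  have -> : x t = X k t.
    by apply: xX; apply: le_trans (KP (t + 1)); rewrite lerDl.
  apply: (@cvg_trans _ (X k s @[s --> t])).
    apply: near_eq_cvg; near=> s; apply/esym/xX; apply: le_trans (KP (t + 1)).
    by near: s; apply: lt_le_nbhsl; rewrite ltrDl.
  apply: (@continuous_comp _ _ _ (fun t => t - (b + k%:R * a))
    (fun t => W k (half_clamp t))); last exact: BU_clamp_continuous.
  by apply: continuousB; [exact: cvg_id|exact: cvg_cst].
- apply/funext => s; rewrite /history add0r.
  rewrite (xX 0%N); last by rewrite mul0r addr0 (le_trans (half_le0 _)).
  rewrite /X mul0r addr0 BU_shiftE; congr (w _); apply: half_val_inj.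
  by have := half_le0 s => s0; rewrite half_addE !half_clampE//; lra.
- move=> t t0; pose k := K t; pose r := half_clamp (t - (b + k%:R * a)).
  have tk : t <= b + k%:R * a by exact: KP.
  have rE : half_val r = t - (b + k%:R * a) by rewrite half_clampE ?subr_le0.
  exists (BU_shift (W k) r); last by rewrite -DhatE W0// rE; lra.
  apply/funext => s; have := half_le0 s => s0; rewrite /history.
  rewrite (xX k); last by lra.
  rewrite /X BU_shiftE; congr (W k _); apply: half_val_inj.
  by rewrite half_addE rE half_clampE; lra.
Unshelve. all: by end_near. Qed.

End solution.

(** * A priori estimates from stability, and surjectivity of [T] *)

Hypothesis D_stable : stable D.

Lemma Dhat_fading (e : R) : 0 < e -> exists2 b : R, 0 <= b &
  exists2 K : R, 0 <= K & forall (x : BU) (H : R),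
    0 <= H -> (forall s, - b <= half_val s -> `|T x s| <= H) ->
    `|x (half0 R)| <= e * `|x| + K * H.
Proof.
move=> e0; have [c [_ c_ge0 c0 cP]] := D_stable.
have [b b0 cb] : exists2 b : R, 0 <= b & c b <= e.
  have /cvgr0Pnorm_le /(_ e e0)[M [_ hM]] := c0.
  exists (`|M| + 1) => //; rewrite (le_trans (ler_norm _))//; apply: hM.
  by rewrite (le_lt_trans (ler_norm _))// ltrDl.
have [K K0 hK] := Dhat_solve (b + 1).
exists (b + 1); first by rewrite addr_ge0.
(* One [K] bounds [z] at 0; [e * K] comes from the decayed remainder, where
   [|x - z| <= |x| + K H]. *)
exists (K + e * K) => [|x H H0 xH]; first by rewrite addr_ge0// mulr_ge0// ltW.
(* The cut-off equals [T x] on [[-b, 0]] and vanishes up to [-(b + 1)], so [|z|] depends only on the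
   bound [H] over the window [[-(b + 1), 0]]. *)
have [|z Tz zle] := hK (BU_cut b (T x)).
  by move=> s sb; exact: BU_cut_eq0.
have zH : `|z| <= K * H.
  apply: (le_trans zle); apply: ler_wpM2l => //; apply: BU_norm_le => s.
  have [sb|/ltW sb] := leP (- (b + 1)) (half_val s).
    exact: le_trans (BU_cut_le _ _ _) (xH _ sb).
  by rewrite BU_cut_eq0// normr0.
have w0 s : - b <= half_val s -> T (x - z) s = 0.
  by move=> sb; rewrite DhatB Tz BU_subE BU_cut_id// subrr.
(* The solution [y] starts from the history of [x - z] at [-b]; the stability estimate at time [b]
   bounds [x - z] at 0. *)
have [y [ysol yb]] := Dhat_solution_exists b0 w0.
have := cP _ _ _ ysol _ b0; rewrite yb => /(_ _).
have -> : D (BU_shift (x - z) (half_clamp (- b))) = 0.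
  by rewrite -DhatE w0// half_clampE// oppr_le0.
move=> /(_ erefl) h.
have {}h : `|(x - z) (half0 R)| <= e * (`|x| + K * H).
  apply: (le_trans h); apply: ler_pM => //; first exact: c_ge0.
  rewrite (le_trans (BU_norm_shift _ _))// (le_trans (ler_normB _ _))//.
  by rewrite lerD2l.
rewrite -(subrK (z (half0 R)) (x (half0 R))) (le_trans (ler_normD _ _))//.
have := le_trans (BU_norm_ge z (half0 R)) zH.
rewrite BU_subE in h; lra.
Qed.

Lemma Dhat_fading_shift (e : R) : 0 < e -> exists2 b : R, 0 <= b &
  exists2 K : R, 0 <= K & forall (x : BU) (H : R) t,
    0 <= H -> (forall s, half_val t - b <= half_val s -> `|T x s| <= H) ->
    `|x t| <= e * `|x| + K * H.
Proof.
move=> e0; have [b b0 [K K0 hK]] := Dhat_fading e0.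
exists b => //; exists K => // x H t H0 xH.
have : `|x t| <= e * `|BU_shift x t| + K * H.
  rewrite -[t in x t]half_add0 -BU_shiftE; apply: hK => // s sb.
  by rewrite Dhat_shift BU_shiftE xH// half_addE lerD2l.
by move=> /le_trans; apply; rewrite lerD2r ler_wpM2l ?BU_norm_shift// ltW.
Qed.

(** The factor 1/2 lets [|x|] be absorbed on the left. The estimate gives injectivity of [T] and the
    bound on its inverse. *)
Lemma Dhat_lower_bound : exists2 M : R, 0 <= M & forall x, `|x| <= M * `|T x|.
Proof.
have [b b0 [K K0 hK]] := @Dhat_fading_shift 2^-1 ltac:(by []).
exists (2 * K) => [|x]; first by rewrite mulr_ge0.
have : `|x| <= 2^-1 * `|x| + K * `|T x|.
  by apply: BU_norm_le => t; apply: hK => // s _; exact: BU_norm_ge.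
lra.
Qed.

Lemma Dhat_surjective h : exists x, T x = h.
Proof.
have [M M0 TM] := Dhat_lower_bound.
have /choice[u uP] : forall n : nat, exists u, T u = BU_cut n%:R h.
  move=> n; have [K _ hK] := Dhat_solve (n%:R + 1).
  have [|u Tu _] := hK (BU_cut n%:R h); last by exists u.
  by move=> s; exact: BU_cut_eq0.
have cut_le n : `|BU_cut n%:R h| <= `|h|.
  by apply: BU_norm_le => s; exact: le_trans (BU_cut_le _ _ _) (BU_norm_ge _ _).
have uM n : `|u n| <= M * `|h|.
  by rewrite (le_trans (TM _))// uP ler_wpM2l.
have [||||x [_ Tx _]] := @Dhat_limit u h (M * `|h|) => //; last by exists x.
- move=> e e0; have M1 : 0 < M + 1 by rewrite ltr_wpDl.
  have h1 : 0 < `|h| + 1 by rewrite ltr_wpDl.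
  (* One [r] pays for the oscillation of [h], another for the slope of the cut-off times [|h|]; then
     [M * (r + r) <= e], uniformly in [n]. *)
  pose r := e / 2 / (M + 1); have r0 : 0 < r by rewrite !divr_gt0.
  have /BU_predP[_ /(_ r r0)[d d0 hd]] := valP h.
  exists (Num.min d (r / (`|h| + 1))); first by rewrite lt_min d0 divr_gt0.
  move=> n; apply: BU_osc_shift => q qd.
  apply: (le_trans (TM _)); rewrite DhatB Dhat_shift uP.
  have : `|BU_shift (BU_cut n%:R h) q - BU_cut n%:R h| <= r + r.
    apply: BU_shift_osc qd => s t; rewrite lt_min => /andP[/hd/ltW st1].
    rewrite ltr_pdivlMr// => /ltW st2.
    apply: (le_trans (BU_cut_lip _ _ _ _)); apply: lerD => //.
    by apply: le_trans st2; rewrite mulrC ler_wpM2l// lerDl.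
  move=> /(ler_wpM2l M0)/le_trans; apply.
  have -> : r + r = e / (M + 1) by rewrite /r mulrAC -splitr.
  by rewrite mulrCA ger_pMr// ler_pdivrMr// mul1r lerDl.
- move=> b e e0; have h1 : 0 < M * `|h| + M * `|h| + 1.
    by rewrite ltr_wpDl// addr_ge0// mulr_ge0.
  have e'0 : 0 < e / (M * `|h| + M * `|h| + 1) by rewrite divr_gt0.
  have [c c0 [K K0 hK]] := Dhat_fading_shift e'0.
  (* For [n] and [p] above [b + c], both cut-offs equal [h] on [[-b - c, 0]], so [T (u n - u p)]
     vanishes there and the fading estimate applies with [H = 0]. *)
  exists (Num.truncn (`|b + c|)).+1 => n p nn pp s sb.
  have le_n (k : nat) : (Num.truncn `|b + c|%R < k)%N -> b + c <= k%:R.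
    move=> kn; rewrite (le_trans (ler_norm _))//.
    by rewrite (le_trans (ltW (truncnS_gt _)))// ler_nat.
  have := hK (u n - u p) 0 s (lexx _); rewrite mulr0 addr0.
  move=> /(_ _)/le_trans; apply.
    move=> t tc; rewrite DhatB !uP BU_subE.
    rewrite !BU_cut_id ?subrr ?normr0//.
      by have := le_n _ pp; lra.
    by have := le_n _ nn; lra.
  rewrite mulrAC ler_pdivrMr//; apply: ler_wpM2l; first exact: ltW.
  rewrite (le_trans (ler_normB _ _))// (le_trans (lerD (uM n) (uM p)))//.
  by rewrite lerDl.
- move=> s e e0; exists (Num.truncn `|half_val s|).+1 => n ns.
  have sn : - n%:R <= half_val s.
    rewrite lerNl -ler0_norm ?half_le0// (le_trans (ltW (truncnS_gt _)))//.
    by rewrite ler_nat.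
  by rewrite uP BU_cut_id// subrr normr0 ltW.
Qed.

End Dhat_inverse.

(** * The compact-open metric against uniform closeness on [[-b, 0]] *)

Section codist_estimates.
Context {R : realType} {m : nat}.
Local Notation BU := (BU R m).

Lemma seminorm_le (x : BU) n M :
  (forall s, - n%:R <= half_val s -> `|x s| <= M) -> seminorm n x <= M.
Proof.
move=> xM; apply: ge_sup => [|_ [s /= sn <-]]; last exact: xM.
by exists `|x (half0 R)|, (half0 R) => //=; rewrite oppr_le0.
Qed.

Lemma seminorm_ge (x : BU) n s :
  - n%:R <= half_val s -> `|x s| <= seminorm n x.
Proof.
move=> sn; apply: ub_le_sup; last by exists s.
by exists `|x| => _ [t _ <-]; exact: BU_norm_ge.
Qed.

Lemma seminorm_ge0 (x : BU) n : 0 <= seminorm n x.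
Proof.
by rewrite (le_trans _ (@seminorm_ge x n (half0 R) _))// oppr_le0.
Qed.

Let q (x : BU) n : R := 2^-1 ^+ n * (seminorm n x / (1 + seminorm n x)).

Let ratio_le1 (p : R) : 0 <= p -> p / (1 + p) <= 1.
Proof. by move=> p0; rewrite ler_pdivrMr ?ltr_pwDl// mul1r lerDr. Qed.

Let q_ge0 x n : 0 <= q x n.
Proof.
have p0 := seminorm_ge0 x n.
by rewrite mulr_ge0 ?exprn_ge0// divr_ge0// addr_ge0.
Qed.

(** Terms with [n <= b] are at most [e 2^-n], the later ones at most [2^-n]. The right-hand side
    adds the exact partial sums of these two geometric series, the maximum being 0 while [k <= b];
    this form suits induction on [k]. *)
Let q_sum_le (x : BU) (b : nat) (e : R) : 0 <= e ->
  (forall s, - b%:R <= half_val s -> `|x s| <= e) ->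
  forall k, \sum_(1 <= n < k.+1) q x n <=
    e * (1 - 2^-1 ^+ k) + Num.max 0 (2^-1 ^+ b - 2^-1 ^+ k).
Proof.
move=> e0 xe; elim=> [|k IH].
  by rewrite big_geq// expr0 subrr mulr0 add0r le_max lexx.
rewrite big_nat_recr//= -/(q x k.+1).
have u0 : 0 <= 2^-1 ^+ k.+1 :> R by rewrite exprn_ge0.
have uS : 2^-1 ^+ k = 2 * 2^-1 ^+ k.+1 :> R.
  by rewrite exprS mulrA divff// mul1r.
have decr i j : (i <= j)%N -> 2^-1 ^+ j <= 2^-1 ^+ i :> R.
  by move=> ij; rewrite ler_wiXn2l// invf_le1// ler1n.
have p0 := seminorm_ge0 x k.+1.
have [kb|bk] := leqP k.+1 b.
  have qe : q x k.+1 <= 2^-1 ^+ k.+1 * e.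
    apply: ler_wpM2l => //; apply: (@le_trans _ _ (seminorm k.+1 x)).
      by rewrite ler_pdivrMr ?ltr_pwDl// ler_peMr// lerDl.
    apply: seminorm_le => s sk; apply: xe; apply: le_trans sk.
    by rewrite lerN2 ler_nat.
  have bu := decr _ _ kb.
  have : 0 <= Num.max 0 (2^-1 ^+ b - 2^-1 ^+ k.+1) :> R by rewrite le_max lexx.
  move: IH; rewrite uS (@max_l _ _ 0 (_ - 2 * _)); [nra|lra].
have q1 : q x k.+1 <= 2^-1 ^+ k.+1 by rewrite ler_piMr// ratio_le1.
have := decr b k bk; rewrite uS => bu.
move: IH; rewrite uS !max_r; [nra|lra|lra].
Qed.

Let q_sum_ndecr (x : BU) :
  nondecreasing_seq (fun k => \sum_(1 <= n < k) q x n).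
Proof.
apply/nondecreasing_seqP => -[|k]; first by rewrite !big_geq.
by rewrite [leRHS]big_nat_recr//= lerDl.
Qed.

Let q_sum_bound (x : BU) (b : nat) (e : R) : 0 <= e ->
  (forall s, - b%:R <= half_val s -> `|x s| <= e) ->
  forall k, \sum_(1 <= n < k) q x n <= e + 2^-1 ^+ b.
Proof.
move=> e0 xe k; apply: (le_trans (q_sum_ndecr x (leqnSn k))).
apply: (le_trans (q_sum_le e0 xe k)); apply: lerD.
  by rewrite ler_piMr// gerDl oppr_le0 exprn_ge0.
by rewrite ge_max exprn_ge0//= gerDl oppr_le0 exprn_ge0.
Qed.

Let q_sum_cvg (x : BU) : cvgn (fun k => \sum_(1 <= n < k) q x n).
Proof.
apply: nondecreasing_is_cvgn; first exact: q_sum_ndecr.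
exists (`|x| + 2^-1 ^+ 0) => _ [k _ <-].
by apply: q_sum_bound => // s _; exact: BU_norm_ge.
Qed.

Let codistE (x y : BU) :
  codist x y = limn (fun k => \sum_(1 <= n < k) q (x - y) n).
Proof. by []. Qed.

Lemma codist_le (x y : BU) (b : nat) (e : R) : 0 <= e ->
  (forall s, - b%:R <= half_val s -> `|x s - y s| <= e) ->
  codist x y <= e + 2^-1 ^+ b.
Proof.
move=> e0 xe; rewrite codistE; apply: limr_le; first exact: q_sum_cvg.
by apply: nearW => k; apply: (q_sum_bound (x := x - y)).
Qed.

(** A single term is at most the whole sum, and [p / (1 + p)] increases with [p]. The term of index
    [b + 1] is used because the series starts at 1 while [b] may be 0. *)
Lemma codist_small (b : nat) (e : R) : 0 < e -> exists2 d : R, 0 < d &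
  forall x y : BU, codist x y < d ->
    forall s, - b%:R <= half_val s -> `|x s - y s| <= e.
Proof.
move=> e0; have e1 : 0 < 1 + e by rewrite addr_gt0.
have u0 : 0 < 2^-1 ^+ b.+1 :> R by rewrite exprn_gt0.
exists (2^-1 ^+ b.+1 * (e / (1 + e))); first by rewrite mulr_gt0// divr_gt0.
move=> x y xy s sb; set p := seminorm b.+1 (x - y).
have p1 : 0 < 1 + p by rewrite ltr_pwDl// seminorm_ge0.
apply: (@le_trans _ _ p).
  by apply: (@seminorm_ge (x - y)); apply: le_trans sb; rewrite lerN2 ler_nat.
have : 2^-1 ^+ b.+1 * (p / (1 + p)) < 2^-1 ^+ b.+1 * (e / (1 + e)).
  apply: le_lt_trans xy; rewrite codistE.
  apply: (@le_trans _ _ (\sum_(1 <= n < b.+2) q (x - y) n)).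
    by rewrite big_nat_recr//= lerDr sumr_ge0.
  by apply: nondecreasing_cvgn_le; [exact: q_sum_ndecr|exact: q_sum_cvg].
rewrite ltr_pM2l// ltr_pdivrMr// mulrAC ltr_pdivlMr//; nra.
Qed.

End codist_estimates.

(** * Construction of the inverse and its uniform continuity on balls *)

Theorem theorem3p8 (R : realType) (m : nat)
  (D : {linear BU R m -> 'cV[R]_m})
  (nu : 'I_m -> 'I_m -> {charge set (halfline R) -> \bar R})
  (D1 : continuous D)
  (D2 : compact_open_continuous D)
  (D3 : atomic_at0 D)
  (nu_regular : forall i j, regular_charge (nu i j))
  (nu_at0 : forall i j, charge_tv (nu i j) [set half0 R] = 0%E)
  (D_form : forall x : BU R m, D x = x (half0 R) - mx_integral nu x)
  (D_stable : stable D) :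
  exists Dinv : BU R m -> BU R m,
    [/\ cancel (Dhat D1) Dinv,
        cancel Dinv (Dhat D1),
        exists M : R, forall h : BU R m, `|Dinv h| <= M * `|h| &
        forall r eps : R, 0 < r -> 0 < eps ->
          exists2 delta : R, 0 < delta &
            forall h1 h2 : BU R m, BU_ball r h1 -> BU_ball r h2 ->
              codist h1 h2 < delta -> codist (Dinv h1) (Dinv h2) < eps].
Proof.
have D_tail : forall e : R, 0 < e -> exists n : nat, exists2 C : R, 0 <= C &
    forall (x : BU R m) (d : R), 0 <= d ->
      (forall s, - n%:R <= half_val s -> `|x s| <= d) ->
      `|D x| <= C * d + e * `|x|.
  move=> e /(@mx_integral_tail R m nu)[n [C C0 hC]].
  (* The summand 1 accounts for the term [x(0)] of [D x]. *)
  exists n, (1 + C) => [|x d d0 xd]; first by rewrite addr_ge0.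
  rewrite D_form (le_trans (ler_normB _ _))// mulrDl mul1r -addrA.
  by rewrite lerD ?hC// xd// oppr_le0.
have [a a0 a_near0] := @mx_integral_near0 R m nu nu_at0 2^-1 ltac:(by []).
have D_near0 (x : BU R m) : (forall s, half_val s <= - a -> x s = 0) ->
    `|x (half0 R) - D x| <= 2^-1 * `|x|.
  by move=> /a_near0; rewrite D_form opprB addrC subrK.
have [M M0 TM] := Dhat_lower_bound D1 D_tail a0 D_near0 D_stable.
have [Dinv DinvK] := choice (Dhat_surjective D1 D_tail a0 D_near0 D_stable).
have Dinv_le h : `|Dinv h| <= M * `|h| by rewrite (le_trans (TM _))// DinvK.
have DhatK : cancel (Dhat D1) Dinv.
  move=> x; apply/subr0_eq/normr0_eq0/eqP; rewrite eq_le normr_ge0 andbT.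
  by rewrite (le_trans (TM _))// DhatB DinvK subrr normr0 mulr0.
exists Dinv; split=> //; first by exists M.
move=> r eps r0 eps0.
(* One quarter of [eps] each goes to the tail [2^-b] of the metric, the fading term and the term in
   [h1 - h2]; the last quarter makes the inequality strict. *)
have [b hb] := @geometric_small R 1 (eps / 4) ltac:(by rewrite divr_gt0).
(* [M * (r + r)] bounds the norm of [Dinv h1 - Dinv h2] for [h1] and [h2] in the ball of radius
   [r]. *)
have Mr : 0 < M * (r + r) + 1 by rewrite ltr_wpDl// mulr_ge0// addr_ge0// ltW.
have e'0 : 0 < eps / 4 / (M * (r + r) + 1) by rewrite !divr_gt0.
have [c c0 [K K0 hK]] :=
  Dhat_fading_shift D1 D_tail a0 D_near0 D_stable e'0.
have K1 : 0 < K + 1 by rewrite ltr_wpDl.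
have e0 : 0 < eps / 4 / (K + 1) by rewrite !divr_gt0.
(* At points of [[-b, 0]] the fading estimate looks at [h1 - h2] on [[-b - c, 0]]; the truncation
   plus one rounds [b + c] up to a natural number. *)
have [d d0 hd] := @codist_small R m (Num.truncn (b%:R + c)).+1 _ e0.
exists d => // h1 h2 h1r h2r /hd h12.
have e4 : 0 <= eps / 4 by rewrite divr_ge0// ltW.
suff : codist (Dinv h1) (Dinv h2) <= eps / 4 + eps / 4 + 2^-1 ^+ b.
  by move=> /le_lt_trans; apply; have := hb b (leqnn b); rewrite mulr1; lra.
apply: codist_le => [|s sb]; first exact: addr_ge0.
rewrite -BU_subE.
apply: (le_trans (hK _ (eps / 4 / (K + 1)) s (ltW e0) _)) => [t ts|].
  rewrite DhatB !DinvK; apply: h12.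
  have := truncnS_gt (b%:R + c); lra.
apply: lerD.
  rewrite mulrAC ler_pdivrMr//; apply: ler_wpM2l => //.
  rewrite (@le_trans _ _ (M * (r + r)))// ?lerDl//.
  rewrite (le_trans (TM _))// ler_wpM2l// DhatB !DinvK.
  by rewrite (le_trans (ler_normB _ _))// lerD.
by rewrite mulrCA; apply: ler_piMr => //; rewrite ler_pdivrMr// mul1r lerDl.
Qed.
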